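(* Let $d\ge1$, fix a state $s$, let $a^1\sim\pi_\beta(\cdot|s)$, where $\pi_\beta(\cdot|s)$ is a probability density on $\mathbb{R}^d$, and let $z\sim\mathcal{N}(0,I_d)$ be independent of $a^1$. For $t\in(0,1)$ define $a^t = t a^1+(1-t)z$ and let $p_t(\cdot|s)$ be the density of $a^t$. Then for all $t\in(0,1)$ and $x\in\mathbb{R}^d$, $$\nabla_x\log p_t(x|s)=\frac{t\,\mathbb{E}[a^1\mid a^t=x]-x}{(1-t)^2}.$$ Furthermore, with the velocity field $v(t,s,x)=\mathbb{E}[a^1-z\mid a^t=x]$, the score function can be equivalently expressed as $$\nabla_x\log p_t(x|s)=\frac{t\,v(t,s,x)-x}{1-t}.$$
   Context: The state $s$ is a fixed parameter. The conditional law of $a^t$ given $a^1$ is $\mathcal{N}(ta^1,(1-t)^2I_d)$, so $p_t(x|s)=\int_{\mathbb{R}^d}\pi_\beta(y|s)\,\mathcal{N}(x;ty,(1-t)^2I_d)\,dy$, where $\mathcal{N}(x;m,\Sigma)$ is the Gaussian density with mean $m$ and covariance $\Sigma$ evaluated at $x$. Conditional expectations given $a^t=x$ are taken with respect to the conditional density of $a^1$ given $a^t=x$, namely $y\mapsto \pi_\beta(y|s)\,\mathcal{N}(x;ty,(1-t)^2I_d)/p_t(x|s)$, with $z=(x-ta^1)/(1-t)$ on the event $a^t=x$. The field $v$ is the (optimal) flow matching velocity field of the linear Gaussian interpolation path. *)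

(* Defs.v *)
From HB Require Import structures.
From mathcomp Require Import all_boot all_order all_algebra.
From mathcomp Require Import all_classical all_reals all_analysis.

Set Implicit Arguments.
Unset Strict Implicit.
Unset Printing Implicit Defensive.

Import Order.TTheory GRing.Theory Num.Theory.
Import numFieldNormedType.Exports.

Local Open Scope classical_set_scope.
Local Open Scope ring_scope.

(* R^n is 'rV[R]_n with the sigma-algebra generated by the n coordinates,
   which is the Borel sigma-algebra. *)
Definition rV_display : measure_display -> measure_display.
Proof. exact. Qed.

Section measurable_rV.
Context {R : realType} (n : nat).

Let coor : 'I_n -> 'rV[R]_n -> R := fun i x => x ord0 i.

HB.instance Definition _ :=
  @isMeasurable.Build (rV_display default_measure_display)
    'rV[R]_n (g_sigma_preimage coor) (@sigma_algebra0 _ _ _)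
    (fun A => @sigma_algebraC _ _ A) (@sigma_algebra_bigcup _ _ _).

End measurable_rV.

Section measurable_rV_theory.
Context {R : realType}.

Lemma measurable_coor n (i : 'I_n) :
  measurable_fun [set: 'rV[R]_n] (fun x => x ord0 i : R).
Proof.
move=> _ Y mY; rewrite setTI; apply: sub_sigma_algebra => /=.
rewrite -bigcup_seq/=; exists i => /=; first by rewrite mem_index_enum.
by exists Y => //; rewrite setTI.
Qed.

Lemma measurable_fun_rVP d (T : measurableType d) n (f : T -> 'rV[R]_n) :
  measurable_fun [set: T] f <->
  forall i, measurable_fun [set: T] (fun x => f x ord0 i : R).
Proof.
apply: (@iff_trans _ (g_sigma_preimage
    (fun i => (fun x : 'rV[R]_n => x ord0 i : R) \o f) `<=` measurable)).
  rewrite g_sigma_preimage_comp; split=> [mf A [/= C preC <-]|prefS].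
    exact: mf.
  by move=> _ A mA; apply: prefS; exists A.
split=> [fS i|mf].
- move=> _ A mA; apply: fS; apply: sub_sigma_algebra.
  rewrite -bigcup_seq/=; exists i => /=; first by rewrite mem_index_enum.
  by exists A.
- apply: smallest_sub; first exact: sigma_algebra_measurable.
  rewrite -bigcup_seq/=; apply: bigcup_sub => i _.
  by move=> A [B mB <-]; exact: mf.
Qed.

Definition cons_rV n (u : measurableTypeR R * 'rV[R]_n) : 'rV[R]_n.+1 :=
  \row_i (if unlift ord0 i is Some j then u.2 ord0 j else u.1).

Definition uncons_rV n (x : 'rV[R]_n.+1) : measurableTypeR R * 'rV[R]_n :=
  (x ord0 ord0, \row_j x ord0 (lift ord0 j)).

Lemma cons_rVK n : cancel (@cons_rV n) (@uncons_rV n).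
Proof.
move=> [a v]; rewrite /uncons_rV /cons_rV !mxE unlift_none /=; congr pair.
by apply/rowP => j; rewrite !mxE liftK.
Qed.

Lemma uncons_rVK n : cancel (@uncons_rV n) (@cons_rV n).
Proof.
move=> x; apply/rowP => i; rewrite /uncons_rV /cons_rV !mxE /=.
by case: unliftP => [j|] ->; rewrite ?mxE.
Qed.

Lemma measurable_cons_rV n : measurable_fun setT (@cons_rV n).
Proof.
apply/measurable_fun_rVP => i.
rewrite (_ : (fun _ => _) = (fun u : measurableTypeR R * 'rV[R]_n =>
    if unlift ord0 i is Some j then u.2 ord0 j else u.1 : R)); last first.
  by apply/funext => u; rewrite /cons_rV mxE.
case: (unlift ord0 i) => [j|]; last exact: measurable_fst.
exact: (measurableT_comp (@measurable_coor n j) measurable_snd).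
Qed.

Lemma measurable_uncons_rV n : measurable_fun setT (@uncons_rV n).
Proof.
apply: measurable_fun_pair; first exact: measurable_coor.
apply/measurable_fun_rVP => j.
rewrite (_ : (fun _ => _) = (fun x : 'rV[R]_n.+1 => x ord0 (lift ord0 j) : R)).
  exact: measurable_coor.
by apply/funext => x; rewrite mxE.
Qed.

End measurable_rV_theory.

(* Lebesgue measure on R^n, by iterated products: a point mass on R^0, and the
   image of (lebesgue_measure \x lebesgue_rV n) under R * R^n -> R^n.+1. *)
Section lebesgue_cons.
Local Open Scope ereal_scope.
Context {R : realType} (n : nat).
Variable mu : {sigma_finite_measure set 'rV[R]_n -> \bar R}.

Definition lebesgue_cons : set 'rV[R]_n.+1 -> \bar R :=
  pushforward (lebesgue_measure \x mu) (@cons_rV R n).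

Let measurable_preimage_cons (A : set 'rV[R]_n.+1) :
  measurable A -> measurable (@cons_rV R n @^-1` A).
Proof.
by move=> mA; rewrite -[X in measurable X]setTI; exact: measurable_cons_rV.
Qed.

Let lebesgue_cons0 : lebesgue_cons set0 = 0.
Proof. by rewrite /lebesgue_cons /pushforward preimage_set0 measure0. Qed.

Let lebesgue_cons_ge0 A : 0 <= lebesgue_cons A.
Proof. exact: (measure_ge0 (lebesgue_measure \x mu)). Qed.

Let lebesgue_cons_sigma_additive : semi_sigma_additive lebesgue_cons.
Proof.
move=> F mF tF mUF; rewrite /lebesgue_cons /pushforward preimage_bigcup.
apply: measure_semi_sigma_additive.
- by move=> k; exact: measurable_preimage_cons.
- apply/trivIsetP => /= i j _ _ ij; rewrite -preimage_setI.
  by move/trivIsetP : tF => /(_ _ _ _ _ ij) ->//; rewrite preimage_set0.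
- by rewrite -preimage_bigcup; exact: measurable_preimage_cons.
Qed.

HB.instance Definition _ := isMeasure.Build _ _ _ lebesgue_cons
  lebesgue_cons0 lebesgue_cons_ge0 lebesgue_cons_sigma_additive.

Let lebesgue_cons_sigma_finite : sigma_finite setT lebesgue_cons.
Proof.
have /sigma_finiteP[F [TF ndF Foo]] := sigma_finiteT (@lebesgue_measure R).
have /sigma_finiteP[G [TG ndG Goo]] := sigma_finiteT mu.
have UFG : \bigcup_k (F k `*` G k) = setT.
  apply/seteqP; split=> // -[x y] _.
  have [k _ Fkx] : (\bigcup_k F k) x by rewrite -TF.
  have [l _ Gly] : (\bigcup_k G k) y by rewrite -TG.
  exists (maxn k l) => //; split => /=.
    by move: Fkx; exact/subsetPset/ndF/leq_maxl.
  by move: Gly; exact/subsetPset/ndG/leq_maxr.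
exists (fun k => @uncons_rV R n @^-1` (F k `*` G k)).
  by rewrite -preimage_bigcup UFG preimage_setT.
move=> k; have [mF Fk] := Foo k; have [mG Gk] := Goo k; split.
  rewrite -[X in measurable X]setTI; apply: measurable_uncons_rV => //.
  exact: measurableX.
rewrite /lebesgue_cons /pushforward -comp_preimage.
rewrite (_ : @uncons_rV R n \o @cons_rV R n = id); last first.
  by apply/funext => u; exact: cons_rVK.
by rewrite preimage_id product_measure1E// lte_mul_pinfty// ge0_fin_numE.
Qed.

HB.instance Definition _ := Measure_isSigmaFinite.Build _ _ _ lebesgue_cons
  lebesgue_cons_sigma_finite.

End lebesgue_cons.

Fixpoint lebesgue_rV {R : realType} (n : nat) :
    {sigma_finite_measure set 'rV[R]_n -> \bar R} :=
  match n with
  | 0 => @dirac _ 'rV[R]_0 0 R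
  | n'.+1 => lebesgue_cons (lebesgue_rV n')
  end.

Lemma lebesgue_rV_box (R : realType) n (A : 'I_n -> set R) :
  (forall i, measurable (A i)) ->
  lebesgue_rV n [set x | forall i, A i (x ord0 i)] =
  (\prod_i lebesgue_measure (A i))%E.
Proof.
elim: n => [|n IH] in A * => mA.
  by rewrite big_ord0 /= diracE mem_set//; case.
rewrite big_ord_recl -IH//= /lebesgue_cons /pushforward.
rewrite -product_measure1E; last 2 first.
- exact: mA.
- rewrite (_ : (fun _ => _) = \bigcap_(i in [set: 'I_n])
    [set x : 'rV[R]_n | A (lift ord0 i) (x ord0 i)]); last first.
    by apply/seteqP; split=> x /= h => [i _|i]; exact: h.
  apply: fin_bigcap_measurable => // i _.
  by rewrite -[X in measurable X]setTI; exact: measurable_coor.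
congr (_ \x _)%E; apply/seteqP; split => -[a v] /= h.
  split => [|i].
    by have := h ord0; rewrite mxE unlift_none.
  by have := h (lift ord0 i); rewrite mxE liftK.
by move=> i; rewrite mxE; case: unliftP => [j|] ->; [exact: h.2|exact: h.1].
Qed.

Section densities.
Context {R : realType}.

Definition is_pdf d (rho : 'rV[R]_d -> R) : Prop :=
  [/\ measurable_fun setT rho, forall x, 0 <= rho x &
      (\int[lebesgue_rV d]_x (rho x)%:E = 1)%E].

Definition has_density disp (Omega : measurableType disp)
    (P : probability Omega R) disp' (T : measurableType disp')
    (mu : set T -> \bar R) (X : Omega -> T) (f : T -> R) : Prop :=
  forall A, measurable A -> P (X @^-1` A) = (\int[mu]_(x in A) (f x)%:E)%E.

Definition independent_rv disp (Omega : measurableType disp)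
    (P : probability Omega R) disp1 (T1 : measurableType disp1)
    disp2 (T2 : measurableType disp2)
    (X : {RV P >-> T1}) (Y : {RV P >-> T2}) : Prop :=
  forall A B, measurable A -> measurable B ->
    P (X @^-1` A `&` Y @^-1` B) = (P (X @^-1` A) * P (Y @^-1` B))%E.

(* N(x; m, Sigma) for an invertible covariance matrix Sigma. *)
Definition gaussian_pdf d (m : 'rV[R]_d) (Sigma : 'M[R]_d) (x : 'rV[R]_d) : R :=
  (Num.sqrt ((2 * pi) ^+ d * \det Sigma))^-1 *
  expR (- (((x - m) *m invmx Sigma *m (x - m)^T) ord0 ord0 / 2)).

Definition gradient d (f : 'rV[R]_d -> R) (x : 'rV[R]_d) : 'rV[R]_d :=
  \row_i 'D_(delta_mx ord0 i) f x.

End densities.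

(* In this section rho is the density of a^1. *)
Section interpolation.
Context {R : realType} (d : nat).
Implicit Types (rho : 'rV[R]_d -> R) (t : R) (x y : 'rV[R]_d)
  (g : 'rV[R]_d -> 'rV[R]_d -> 'rV[R]_d).

Definition interp t (a1 z : 'rV[R]_d) : 'rV[R]_d := t *: a1 + (1 - t) *: z.

(* N(x; t y, (1 - t)^2 I_d), the conditional density of a^t given a^1 = y. *)
Definition interp_kernel t y x : R :=
  gaussian_pdf (t *: y) (((1 - t) ^+ 2)%:M) x.

Definition interp_pdf rho t x : R :=
  \int[lebesgue_rV d]_y (rho y * interp_kernel t y x).

(* Conditional density of a^1 at y given a^t = x. *)
Definition cond_pdf rho t x y : R :=
  rho y * interp_kernel t y x / interp_pdf rho t x.

(* The value of z on the event a^t = x, a^1 = y. *)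
Definition noise t x y : 'rV[R]_d := (1 - t)^-1 *: (x - t *: y).

Definition cond_integrable rho t x g : Prop :=
  forall i : 'I_d, (lebesgue_rV d).-integrable setT
    (fun y => (g y (noise t x y) ord0 i * cond_pdf rho t x y)%:E).

(* E[g(a^1, z) | a^t = x], coordinate by coordinate. *)
Definition cond_expect rho t x g : 'rV[R]_d :=
  \row_i \int[lebesgue_rV d]_y
    (g y (noise t x y) ord0 i * cond_pdf rho t x y).

End interpolation.

Definition velocity {R : realType} d (S : Type) (pi_beta : S -> 'rV[R]_d -> R)
    (t : R) (s : S) (x : 'rV[R]_d) : 'rV[R]_d :=
  cond_expect (pi_beta s) t x (fun a1 z => a1 - z).

(* Main.v *)
Require Import Defs.
From HB Require Import structures.
From mathcomp Require Import all_boot all_order all_algebra.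
From mathcomp Require Import all_classical all_reals all_analysis measurable_realfun.
From mathcomp Require Import ring lra.

(* The kernel [k(y, x) = N(x; t y, (1 - t)^2 I)] satisfies
   [|k(y, x + h) - k(y, x) - dk(h)| <= M |h|^2] with [M] independent of [y]: all
   terms of the expansion are polynomials times a Gaussian, hence bounded.
   Integrating against the density of a^1 bounds the first-order remainder of
   p_t by [M |h|^2], which gives Frechet differentiability directly, without
   dominated convergence. With [m_i = E[(x - t a^1)_i | a^t = x]] the score is
   [- m / (1 - t)^2], and both [a^1] and [a^1 - z] are combinations of [x] and
   [x - t a^1] on the event [a^t = x], which turns this into the two formulas.

   For the densities: by independence (a^1, z) has the product density, and the
   substitution [x = t y + (1 - t) z] in the inner Lebesgue integral carries it
   to the density of (a^1, a^t); the factor [(1 - t)^d] is absorbed by [k]. *)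

Import Order.TTheory GRing.Theory Num.Theory.
Import numFieldNormedType.Exports.

Local Open Scope classical_set_scope.
Local Open Scope ring_scope.

(** * Second-order expansion of a Gaussian *)

Section gaussian_estimates.
Context {R : realType} {d : nat}.
Implicit Types (u h x y : 'rV[R]_d) (q k s N t : R).

Definition sqnorm u : R := \sum_i u ord0 i ^+ 2.

Definition dot u h : R := \sum_i u ord0 i * h ord0 i.

Lemma expR_taylor1_ge0 q : 0 <= expR q - 1 - q.
Proof. by have := expR_ge1Dx q; lra. Qed.

(** The remainder is at most [q * (expR q - 1)]. For [q >= 0] one then uses
    [expR q - 1 <= q * expR q], and for [q <= 0] that [expR q - 1 >= q]. The weight [1 + expR q],
    multiplied by a Gaussian at [u], becomes the sum of the Gaussians at [u] and [u + h]. *)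
Lemma expR_taylor1_le q : expR q - 1 - q <= q ^+ 2 * (1 + expR q).
Proof.
have e0 := expR_gt0 q.
have h1 := expR_ge1Dx q.
have h2 : expR q * (1 - q) <= 1.
  have := expR_ge1Dx (- q); rewrite expRN => h.
  by have := ler_wpM2l (ltW e0) h; rewrite divff ?gt_eqF.
suff : q * (expR q - 1) <= q ^+ 2 * (1 + expR q) by lra.
by have [q0|q0] := leP 0 q; nra.
Qed.

(** Since [1 + r <= expR r] at [r = k * s / 2], [N + s] is at most [(N + 2 / k) * expR (k * s / 2)];
    squaring this uses up the whole decay [expR (- (k * s))]. *)
Lemma sqrD_expRN_le {N k s} : 0 <= N -> 0 < k -> 0 <= s ->
  (N + s) ^+ 2 * expR (- (k * s)) <= (N + 2 / k) ^+ 2.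
Proof.
move=> N0 k0 s0; have k0' : k != 0 by rewrite gt_eqF.
have ik0 : 0 < k^-1 by rewrite invr_gt0.
have h : N + s <= (N + 2 / k) * expR (k * s / 2).
  apply: (@le_trans _ _ ((N + 2 / k) * (1 + k * s / 2))).
    have -> : (N + 2 / k) * (1 + k * s / 2) = N + s + N * (k * s) / 2 + 2 / k.
      by field.
    have : 0 <= N * (k * s) by rewrite !mulr_ge0// ltW.
    by lra.
  by rewrite ler_wpM2l ?expR_ge1Dx//; lra.
have -> : (N + 2 / k) ^+ 2 =
    ((N + 2 / k) * expR (k * s / 2)) ^+ 2 * expR (- (k * s)).
  rewrite exprMn -expRM_natl -[RHS]mulrA -expRD.
  by rewrite (_ : 2%:R * _ - _ = 0) ?expR0 ?mulr1//; field.
rewrite ler_wpM2r ?expR_ge0// lerXn2r ?nnegrE ?addr_ge0//.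
by rewrite (le_trans _ h) ?addr_ge0.
Qed.

Lemma sqnorm_ge0 u : 0 <= sqnorm u.
Proof. by apply: sumr_ge0 => i _; exact: sqr_ge0. Qed.

Lemma sqnormD u h : sqnorm (u + h) = sqnorm u + 2 * dot u h + sqnorm h.
Proof.
rewrite /sqnorm /dot mulr_sumr -!big_split/=; apply: eq_bigr => i _.
by rewrite !mxE; ring.
Qed.

Lemma norm_coord_le u i : `|u ord0 i| <= `|u|.
Proof.
have -> : `|u| = mx_norm u by [].
rewrite mx_normrE.
by apply/bigmax_geP; right; exists (ord0, i).
Qed.

(** Coordinatewise, with [a = |u_i|] and [b = |h_i| <= n = |h| <= 1]: [2 a b <= n (1 + a^2)] and
    [b^2 <= n]. The norm is the maximum norm, so the [d] coordinates contribute [2 * d]. *)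
Lemma abs_dot_sqnorm_le u h : `|h| <= 1 ->
  `|2 * dot u h| + sqnorm h <= `|h| * (2 * d%:R + sqnorm u).
Proof.
move=> h1; rewrite (_ : _ * _ = \sum_(i < d) `|h| * (2 + u ord0 i ^+ 2)); last first.
  by rewrite -mulr_sumr big_split/= sumr_const card_ord -[2 *+ d]mulr_natr.
rewrite /dot mulr_sumr.
apply: (@le_trans _ _ (\sum_i (`|2 * (u ord0 i * h ord0 i)| + h ord0 i ^+ 2))).
  by rewrite big_split/= lerD// ler_norm_sum.
apply: ler_sum => i _; have hi := norm_coord_le h i.
have h0 := normr_ge0 (h ord0 i).
rewrite !normrM ger0_norm// -real_normK ?num_real// -(real_normK (num_real (u ord0 i))).
have u0 := normr_ge0 (u ord0 i).
set a := `|u _ _| in u0 *; set b := `|h _ _| in hi h0 *; set n := `|h| in h1 hi *.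
have : 0 <= (a - 1) ^+ 2 by exact: sqr_ge0.
nra.
Qed.

(** The first term bounds the exponential remainder at the two weights [u] and [u + h], using
    [sqrD_expRN_le] with [N = 2 * d]; the second bounds [k * sqnorm h]. *)
Definition gauss_taylor_cst k : R :=
  2 * (k ^+ 2 * (2 * d%:R + 2 / k) ^+ 2) + k * d%:R.

Lemma sqnorm_le h : sqnorm h <= d%:R * `|h| ^+ 2.
Proof.
rewrite mulr_natl -[X in _ *+ X]card_ord -sumr_const; apply: ler_sum => i _.
by rewrite -(real_normK (num_real (h _ _))) lerXn2r ?nnegrE// norm_coord_le.
Qed.

(** Moving from [u] to [u + h] multiplies the Gaussian by [expR q], so the remainder is
    [w * (expR q - 1 - q)] minus [w * k * sqnorm h]. Each is quadratic in [h], uniformly in [u],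
    because the Gaussian absorbs the polynomial growth of [q ^+ 2]. *)
Lemma gauss_taylor k u h : 0 < k -> `|h| <= 1 ->
  `|expR (- (k * sqnorm (u + h))) - expR (- (k * sqnorm u))
    - - (2 * k) * dot u h * expR (- (k * sqnorm u))|
  <= gauss_taylor_cst k * `|h| ^+ 2.
Proof.
move=> k0 h1; pose q := - (k * (2 * dot u h + sqnorm h)).
set w := expR (- (k * sqnorm u)); set w' := expR (- (k * sqnorm (u + h))).
have w0 : 0 < w by exact: expR_gt0.
have w'0 : 0 < w' by exact: expR_gt0.
have w'E : w' = w * expR q.
  by rewrite /w' /w -expRD sqnormD; congr expR; rewrite /q; ring.
have -> : w' - w - - (2 * k) * dot u h * w
    = w * (expR q - 1 - q) - w * k * sqnorm h.
  by rewrite w'E /q; ring.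
have N0 : 0 <= 2 * d%:R :> R by rewrite mulr_ge0.
have hh := abs_dot_sqnorm_le u h h1.
(* The same increment measured from [u + h], as needed for the weight [w']: it equals
   [2 * dot (u + h) h - sqnorm h]. *)
have hh' : `|2 * dot u h + sqnorm h| <= `|h| * (2 * d%:R + sqnorm (u + h)).
  have := abs_dot_sqnorm_le (u + h) h h1.
  rewrite (_ : dot (u + h) h = dot u h + sqnorm h); last first.
    by rewrite /dot /sqnorm -big_split; apply: eq_bigr => i _; rewrite !mxE/=; ring.
  apply: le_trans.
  have -> : 2 * dot u h + sqnorm h = 2 * (dot u h + sqnorm h) - sqnorm h.
    by ring.
  by rewrite (le_trans (ler_normB _ _))// lerD// ger0_norm ?sqnorm_ge0.
have {}hh : `|2 * dot u h + sqnorm h| <= `|h| * (2 * d%:R + sqnorm u).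
  by rewrite (le_trans (ler_normD _ _))// (ger0_norm (sqnorm_ge0 _)).
(* [q ^+ 2 * (1 + expR q) * w] splits into the weights at [u] and [u + h]. *)
have qE (v : 'rV[R]_d) : `|2 * dot u h + sqnorm h| <= `|h| * (2 * d%:R + sqnorm v) ->
    q ^+ 2 * expR (- (k * sqnorm v))
    <= k ^+ 2 * (2 * d%:R + 2 / k) ^+ 2 * `|h| ^+ 2.
  move=> hv; rewrite /q sqrrN exprMn -(real_normK (num_real (_ + _))).
  apply: (@le_trans _ _ (k ^+ 2 * (`|h| * (2 * d%:R + sqnorm v)) ^+ 2 *
                          expR (- (k * sqnorm v)))).
    rewrite ler_wpM2r ?expR_ge0// ler_wpM2l ?sqr_ge0// lerXn2r ?nnegrE//.
    by rewrite mulr_ge0// addr_ge0 ?sqnorm_ge0.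
  have kh0 : 0 <= k ^+ 2 * `|h| ^+ 2 by rewrite mulr_ge0 ?sqr_ge0.
  rewrite [leRHS]mulrAC; apply: le_trans (ler_wpM2l kh0 (sqrD_expRN_le N0 k0 (sqnorm_ge0 v))).
  by rewrite exprMn !mulrA.
have A1 := qE _ hh; have A2 := qE _ hh'.
have T0 := expR_taylor1_ge0 q; have T1 := expR_taylor1_le q.
have B : 0 <= w * (expR q - 1 - q)
    <= 2 * (k ^+ 2 * (2 * d%:R + 2 / k) ^+ 2) * `|h| ^+ 2.
  rewrite mulr_ge0 ?(ltW w0)//=.
  apply: (@le_trans _ _ (q ^+ 2 * w + q ^+ 2 * w')); last by rewrite /w /w'; lra.
  by rewrite w'E; have := ler_wpM2l (ltW w0) T1; lra.
have w1 : w <= 1.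
  by rewrite -expR0 ler_expR oppr_le0 mulr_ge0 ?sqnorm_ge0 ?ltW.
have D : 0 <= w * k * sqnorm h <= k * d%:R * `|h| ^+ 2.
  have s0 := sqnorm_ge0 h; have s1 := sqnorm_le h.
  rewrite !mulr_ge0 ?(ltW w0) ?(ltW k0)//=.
  apply: (@le_trans _ _ (1 * k * sqnorm h)).
    by rewrite ler_wpM2r// ler_wpM2r// ltW.
  by rewrite mul1r -mulrA ler_wpM2l ?(ltW k0).
rewrite /gauss_taylor_cst mulrDl (le_trans (ler_normB _ _))//.
case/andP : B => B0 B1; case/andP : D => D0 D1.
by rewrite (ger0_norm B0) (ger0_norm D0) lerD.
Qed.

End gaussian_estimates.

(** * Gaussian densities with scalar covariance *)

Section kernel.
Context {R : realType} {d : nat}.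
Implicit Types (x y m : 'rV[R]_d) (t s : R).

Definition gauss_cst s : R := (Num.sqrt ((2 * pi) ^+ d * (s ^+ 2) ^+ d))^-1.

(** Half the inverse variance, so that the exponent of the Gaussian is [- precision s * sqnorm]. *)
Definition precision s : R := (2 * s ^+ 2)^-1.

Lemma gauss_cst_gt0 s : s != 0 -> 0 < gauss_cst s.
Proof.
move=> s0; rewrite invr_gt0 sqrtr_gt0 mulr_gt0// exprn_gt0//.
  by rewrite mulr_gt0 ?pi_gt0.
by rewrite exprn_even_gt0.
Qed.

Lemma gaussian_pdf_scalarE s m x : s != 0 ->
  gaussian_pdf m ((s ^+ 2)%:M) x
  = gauss_cst s * expR (- (precision s * sqnorm (x - m))).
Proof.
move=> s0; rewrite /gaussian_pdf det_scalar; congr (_ * expR (- _)).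
rewrite invmx_scalar mul_mx_scalar -scalemxAl mxE mxE /precision.
rewrite mulrC mulrA; congr (_ * _); first by rewrite !invfM.
by apply: eq_bigr => i _; rewrite !mxE -expr2.
Qed.

End kernel.

(** * Differentials *)

Section differentials.
Context {R : realType}.

(** A quadratic remainder is [o(h)], and a continuous linear map with an [o(h)] remainder is the
    differential by uniqueness. *)
Lemma is_diff_quadratic (V : normedModType R) (f : V -> R)
    (L : {linear V -> R}) (x : V) (M : R) :
  continuous L ->
  (forall h, `|h| <= 1 -> `|f (x + h) - f x - L h| <= M * `|h| ^+ 2) ->
  is_diff x f L.
Proof.
move=> Lc fL.
have fE : f \o shift x = cst (f x) + L +o_ 0 id.
  apply/eqaddoP => _/posnumP[e]; near=> h.
  have h1 : `|h| <= 1 by near: h; exact: nbhs0_le.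
  (* The denominator [|M| + 1] is positive whatever the sign of [M]. *)
  have hM : `|h| <= e%:num / (`|M| + 1).
    by near: h; apply: nbhs0_le; rewrite divr_gt0// ltr_wpDl.
  have -> : (f \o shift x - (cst (f x) + L)) h = f (x + h) - f x - L h.
    by rewrite [x + h]addrC -addrA -opprD.
  rewrite (le_trans (fL _ h1))// expr2 mulrA ler_wpM2r//.
  rewrite ler_pdivlMr ?ltr_wpDl// in hM.
  have := ler_norm M; have := normr_ge0 h; nra.
have dE := diff_unique Lc fE.
by apply: DiffDef => //; apply/diff_locallyP; rewrite dE.
Unshelve. all: by end_near. Qed.

Lemma dot_is_linear d (g : 'rV[R]_d) : linear (dot g).
Proof.
move=> a u v; rewrite /dot scaler_sumr -big_split/=; apply: eq_bigr => i _.
by rewrite !mxE mulrDr mulrCA.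
Qed.

HB.instance Definition _ d (g : 'rV[R]_d) :=
  GRing.isLinear.Build R 'rV[R]_d R _ (dot g) (dot_is_linear d g).

Lemma dot_continuous d (g : 'rV[R]_d) : continuous (dot g).
Proof.
rewrite /dot; elim: (index_enum 'I_d) => [|i s ih].
  by under eq_fun do rewrite big_nil; exact: cst_continuous.
under eq_fun do rewrite big_cons.
move=> h; apply: (@continuousD _ _ _ (fun h : 'rV_d => g ord0 i * h ord0 i));
  last exact: ih.
by apply: continuousM; [exact: cst_continuous|exact: coord_continuous].
Qed.

Lemma dot_delta d (g : 'rV[R]_d) i : dot g (delta_mx ord0 i) = g ord0 i.
Proof.
rewrite /dot (bigD1 i)//= big1 ?addr0 => [|j ji]; rewrite !mxE eqxx/=.
  by rewrite eqxx mulr1.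
by rewrite (negbTE ji) mulr0.
Qed.

Lemma is_diff_ln_comp (V : normedModType R) (f df : V -> R) (x : V) :
  is_diff x f df -> 0 < f x ->
  is_diff x (fun y => ln (f y)) (fun h => (f x)^-1 * df h).
Proof.
move=> fdf fx0; have [ln1 ln2] := is_derive1_ln fx0.
have dln : differentiable (@ln R) (f x) by exact/derivable1_diffP.
have df_ : differentiable f x by [].
apply: DiffDef; first exact: (differentiable_comp _ dln).
rewrite (diff_comp df_ dln); apply/funext => h /=.
by rewrite diff1E//= derive1E ln2 diff_val/= mulrC.
Qed.

End differentials.

(** * Measurability of Gaussian densities in mean and argument *)

Section measurability.
Context {R : realType}.

Lemma measurable_sqnorm disp (T : measurableType disp) d (f : T -> 'rV[R]_d) :
  measurable_fun setT f -> measurable_fun setT (fun w => sqnorm (f w)).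
Proof.
move=> /measurable_fun_rVP mf; apply: measurable_sum => i.
exact: measurable_funX.
Qed.

Lemma measurable_rV_lincomb disp (T : measurableType disp) d
    (f g : T -> 'rV[R]_d) (a b : R) :
  measurable_fun setT f -> measurable_fun setT g ->
  measurable_fun setT (fun w => a *: f w + b *: g w).
Proof.
move=> /measurable_fun_rVP mf /measurable_fun_rVP mg.
apply/measurable_fun_rVP => i.
under eq_fun do rewrite !mxE.
by apply: measurable_funD; apply: measurable_funM.
Qed.

Lemma measurable_gaussian_pdf disp (T : measurableType disp) d
    (s : R) (m x : T -> 'rV[R]_d) : s != 0 ->
  measurable_fun setT m -> measurable_fun setT x ->
  measurable_fun setT (fun w => gaussian_pdf (m w) ((s ^+ 2)%:M) (x w)).
Proof.
move=> s0 mm mx; under eq_fun do rewrite gaussian_pdf_scalarE//.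
apply: measurable_funM => //; apply: measurableT_comp => //.
apply: measurableT_comp => //; apply: measurable_funM => //.
apply: measurable_sqnorm.
under eq_fun do rewrite -[x _]scale1r -scaleN1r.
exact: measurable_rV_lincomb.
Qed.

End measurability.

(** * Bounds and expansion of the interpolation kernel, uniform in [y] *)

Section interp_kernel.
Context {R : realType} {d : nat} {t : R} (t1 : 1 - t != 0).
Implicit Types x y : 'rV[R]_d.

Local Notation C := (gauss_cst (d := d) (1 - t)).
Local Notation k := (precision (1 - t)).

Let C0 : 0 < C. Proof. exact: gauss_cst_gt0. Qed.

Let k0 : 0 < k.
Proof. by rewrite invr_gt0 mulr_gt0// exprn_even_gt0. Qed.

Lemma interp_kernelE y x : interp_kernel t y x =
  C *
  expR (- (k * sqnorm (x - t *: y))).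
Proof. exact: gaussian_pdf_scalarE. Qed.

Lemma interp_kernel_gt0 y x : 0 < interp_kernel t y x.
Proof. by rewrite interp_kernelE mulr_gt0 ?expR_gt0. Qed.

Lemma interp_kernel_le y x :
  `|interp_kernel t y x| <= C.
Proof.
rewrite gtr0_norm ?interp_kernel_gt0// interp_kernelE.
rewrite -[leRHS]mulr1 ler_wpM2l ?(ltW C0)//.
by rewrite -[leRHS]expR0 ler_expR oppr_le0 mulr_ge0 ?sqnorm_ge0 ?(ltW k0).
Qed.

(** A coordinate of [u] is at most [(1 + sqnorm u) ^+ 2] in absolute value, so [sqrD_expRN_le]
    applies with [N = 1]. *)
Lemma residual_interp_kernel_le y x i :
  `|(x - t *: y) ord0 i * interp_kernel t y x|
  <= C * (1 + 2 / k) ^+ 2.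
Proof.
rewrite normrM (gtr0_norm (interp_kernel_gt0 _ _)) interp_kernelE mulrCA.
set u := x - t *: y; rewrite ler_wpM2l ?(ltW C0)//.
apply: le_trans (sqrD_expRN_le ler01 k0 (sqnorm_ge0 u)).
rewrite ler_wpM2r ?expR_ge0//.
have s0 := sqnorm_ge0 u.
have : `|u ord0 i| ^+ 2 <= sqnorm u.
  rewrite real_normK ?num_real// /sqnorm (bigD1 i)//= lerDl.
  by apply: sumr_ge0 => j _; exact: sqr_ge0.
have := normr_ge0 (u ord0 i); set a := `|_| => a0; nra.
Qed.

Lemma interp_kernel_taylor y x h : `|h| <= 1 ->
  `|interp_kernel t y (x + h) - interp_kernel t y x
    - - (2 * k) * dot (x - t *: y) h * interp_kernel t y x|
  <= C * gauss_taylor_cst (d := d) k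
     * `|h| ^+ 2.
Proof.
move=> h1; rewrite !interp_kernelE [x + h - _]addrAC.
have := ler_wpM2l (ltW C0) (gauss_taylor k (x - t *: y) h k0 h1).
rewrite mulrA -{1}(gtr0_norm C0) -normrM => /(le_trans _); apply.
by rewrite le_eqVlt; apply/orP; left; apply/eqP; congr `|_|; ring.
Qed.

Lemma measurable_interp_kernel :
  measurable_fun setT (fun w : 'rV[R]_d * 'rV[R]_d => interp_kernel t w.1 w.2).
Proof.
apply: measurable_gaussian_pdf => //.
under eq_fun do rewrite -[_ *: _]addr0 -[in X in _ + X](scale0r 0).
apply: (measurable_rV_lincomb _ _ _ fst (cst 0)) => //.
Qed.

Lemma measurable_interp_kernel1 x :
  measurable_fun setT (interp_kernel t ^~ x).
Proof.
apply: (measurableT_comp measurable_interp_kernel (g := fun y => (y, x))).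
by apply: measurable_fun_pair.
Qed.

End interp_kernel.

(** * Integrability against the kernel, and positivity of p_t *)

Section interp_pdf.
Context {R : realType} {d : nat} {rho : 'rV[R]_d -> R} {t : R}.
Hypotheses (hrho : is_pdf rho) (t1 : 1 - t != 0).
Implicit Types x y : 'rV[R]_d.

Let mu := lebesgue_rV (R := R) d.

Let mrho : measurable_fun setT rho. Proof. by case: hrho. Qed.

Let rho0 y : 0 <= rho y. Proof. by case: hrho. Qed.

Lemma integrable_pdf : mu.-integrable setT (EFin \o rho).
Proof.
apply/integrableP; split; first exact/measurable_EFinP.
under eq_integral do rewrite /= ger0_norm//.
by case: hrho => _ _ ->; rewrite ltry.
Qed.

(** Domination by [M * rho]. The integrals against the kernel reduce to this case because the
    Gaussian makes the other factor bounded. *)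
Lemma integrable_pdfM (b : 'rV[R]_d -> R) (M : R) :
  measurable_fun setT b -> (forall y, `|b y| <= M) ->
  mu.-integrable setT (fun y => (rho y * b y)%:E).
Proof.
move=> mb bM; apply: (le_integrable _ _ _ (integrableZl measurableT M integrable_pdf)) => //.
- by apply/measurable_EFinP; exact: measurable_funM.
- move=> y _; rewrite /= lee_fin normrM mulrC normrM.
  by rewrite ler_wpM2r// (le_trans (bM y))// ler_norm.
Qed.

Lemma integrable_pdf_kernel x :
  mu.-integrable setT (fun y => (rho y * interp_kernel t y x)%:E).
Proof.
apply: (integrable_pdfM _ (gauss_cst (d := d) (1 - t))).
- exact: measurable_interp_kernel1.
- by move=> y; exact: interp_kernel_le.
Qed.

Lemma measurable_residual x i :
  measurable_fun setT (fun y => (x - t *: y) ord0 i).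
Proof.
under eq_fun do rewrite !mxE.
apply: measurable_funB => //; apply: measurable_funM => //.
exact: measurable_coor.
Qed.

Lemma integrable_pdf_residual x i : mu.-integrable setT
  (fun y => (rho y * ((x - t *: y) ord0 i * interp_kernel t y x))%:E).
Proof.
apply: integrable_pdfM => [|y]; last exact: residual_interp_kernel_le.
apply: measurable_funM; first exact: measurable_residual.
exact: measurable_interp_kernel1.
Qed.

(** If the integral vanished, [rho] times the kernel would be 0 almost everywhere; as the kernel is
    positive, so would [rho], whose integral is 1. *)
Lemma interp_pdf_gt0 x : 0 < interp_pdf rho t x.
Proof.
rewrite lt_neqAle Rintegral_ge0 ?andbT; last first.
  by move=> y _; rewrite mulr_ge0// ltW// interp_kernel_gt0.
apply/negP => /eqP; rewrite /interp_pdf /Rintegral => p0.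
(* [Rintegral] also returns 0 on an infinite integral, so [p0] yields a vanishing integral only once
   finiteness is known. *)
have fi := integrable_fin_num measurableT (integrable_pdf_kernel x).
have : (\int[mu]_y `|(rho y * interp_kernel t y x)%:E| = 0)%E.
  under eq_integral => y _.
    rewrite gee0_abs; last by rewrite lee_fin mulr_ge0// ltW// interp_kernel_gt0.
    over.
  by rewrite -[LHS]fineK// -p0.
move/(ae_eq_integral_abs _ measurableT (measurable_int _ (integrable_pdf_kernel x))).
move=> h0; have : ae_eq mu setT (EFin \o rho) (cst 0).
  apply: filterS h0 => y /(_ Logic.I) [/eqP]; rewrite mulf_eq0 => h _.
  move: h; rewrite [X in _ || X]gt_eqF ?interp_kernel_gt0// orbF => /eqP /= ->.
  by [].
move/(ae_eq_integral_abs _ measurableT (measurable_int _ integrable_pdf)).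
case: hrho => _ _ r1.
under eq_integral do rewrite /= ger0_norm//.
by rewrite r1 => /eqP; rewrite onee_eq0.
Qed.

End interp_pdf.

(** * The score *)

Section score.
Context {R : realType} {d : nat} {rho : 'rV[R]_d -> R} {t : R}.
Hypotheses (hrho : is_pdf rho) (t1 : 1 - t != 0).
Implicit Types x y : 'rV[R]_d.

Local Notation mu := (lebesgue_rV (R := R) d).
Local Notation p := (interp_pdf rho t).
Local Notation C := (gauss_cst (d := d) (1 - t)).
Local Notation k := (precision (1 - t)).

(** The expression given by formal differentiation of the Gaussian under the integral sign. *)
Definition interp_grad (rho : 'rV[R]_d -> R) (t : R) x : 'rV[R]_d :=
  \row_i (- (2 * precision (1 - t)) *
    \int[mu]_y (rho y * ((x - t *: y) ord0 i * interp_kernel t y x))).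

(** Integrability and value go through one induction on the list of indices, since additivity of the
    integral at each step requires integrability of the tail. *)
Lemma integral_pdf_residual_dot x h :
  mu.-integrable setT
    (fun y => (rho y * (dot (x - t *: y) h * interp_kernel t y x))%:E) /\
  \int[mu]_y (rho y * (dot (x - t *: y) h * interp_kernel t y x)) =
  \sum_i h ord0 i *
    \int[mu]_y (rho y * ((x - t *: y) ord0 i * interp_kernel t y x)).
Proof.
rewrite /dot; elim: (index_enum 'I_d) => [|i s [ih1 ih2]].
  rewrite big_nil; under eq_fun do rewrite big_nil mul0r mulr0.
  split; first exact: integrable0.
  under eq_Rintegral do rewrite big_nil mul0r mulr0.
  by rewrite Rintegral_cst// mul0r.
have E y : rho y * ((\sum_(j <- i :: s) (x - t *: y) ord0 j * h ord0 j) *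
                    interp_kernel t y x) =
    h ord0 i * (rho y * ((x - t *: y) ord0 i * interp_kernel t y x)) +
    rho y * ((\sum_(j <- s) (x - t *: y) ord0 j * h ord0 j) *
             interp_kernel t y x) by rewrite big_cons; ring.
have i1 := integrableZl measurableT (h ord0 i)
  (integrable_pdf_residual hrho t1 x i).
split.
  under eq_fun do rewrite E EFinD.
  exact: integrableD.
under eq_Rintegral do rewrite E.
rewrite RintegralD// RintegralZl//; last exact: integrable_pdf_residual.
by rewrite big_cons ih2.
Qed.

Lemma is_diff_interp_pdf x : is_diff x p (dot (interp_grad rho t x)).
Proof.
apply: (is_diff_quadratic _ _ _ _ (C * gauss_taylor_cst (d := d) k)).
  exact: dot_continuous.
move=> h h1 /=.
have [iS ES] := integral_pdf_residual_dot x h.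
have -> : dot (interp_grad rho t x) h = \int[mu]_y
    (- (2 * k) * (rho y * (dot (x - t *: y) h * interp_kernel t y x))).
  rewrite RintegralZl// ES /dot mulr_sumr; apply: eq_bigr => i _.
  by rewrite mxE mulrAC -mulrA.
have iZ := integrableZl measurableT (- (2 * k)) iS.
have ix := integrable_pdf_kernel hrho t1 x.
have ixh := integrable_pdf_kernel hrho t1 (x + h).
rewrite /interp_pdf -RintegralB// -RintegralB//; last first.
  exact: (integrableB measurableT ixh ix).
set M := (X in _ <= X).
(* The three merged integrals have integrand [rho y * F y], where [F y] is the Taylor remainder of
   the kernel, bounded by [M] for every [y]. *)
set F := fun y => interp_kernel t y (x + h) - interp_kernel t y x -
  - (2 * k) * dot (x - t *: y) h * interp_kernel t y x.
under eq_Rintegral => y _.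
  rewrite (_ : _ - _ = rho y * F y); last by rewrite /F; ring.
  over.
have iF : mu.-integrable setT (fun y => (rho y * F y)%:E).
  under eq_fun => y.
    rewrite (_ : (rho y * F y)%:E =
      ((rho y * interp_kernel t y (x + h))%:E
      - (rho y * interp_kernel t y x)%:E
      - (- (2 * k) * (rho y * (dot (x - t *: y) h * interp_kernel t y x)))%:E)%E); last first.
      by rewrite -!EFinB /F; congr EFin; ring.
    over.
  by apply: integrableB => //; exact: integrableB.
apply: (le_trans (le_normr_Rintegral measurableT iF)).
have irho : mu.-integrable setT (EFin \o rho) by exact: integrable_pdf.
apply: (@le_trans _ _ (\int[mu]_y (M * rho y))).
  apply: le_Rintegral => //.
  - exact: integrable_norm.
  - exact: (integrableZl measurableT M irho).
  - move=> y _; have rho0 : 0 <= rho y by case: hrho => _ + _; exact.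
    by rewrite normrM mulrC (ger0_norm rho0) ler_wpM2r//; exact: interp_kernel_taylor.
(* The total mass 1 of [rho] turns the pointwise bound [M] into the bound on the remainder of
   p_t. *)
rewrite RintegralZl//= /Rintegral.
by case: hrho => _ _ ->; rewrite /= mulr1.
Qed.

(** This is [1 - t] times the conditional mean of the [i]-th coordinate of the noise given a^t =
    x. *)
Definition cond_residual (rho : 'rV[R]_d -> R) (t : R) x (i : 'I_d) : R :=
  \int[mu]_y ((x - t *: y) ord0 i * cond_pdf rho t x y).

Lemma cond_pdfE x y : cond_pdf rho t x y = (p x)^-1 * (rho y * interp_kernel t y x).
Proof. by rewrite /cond_pdf mulrC. Qed.

Lemma integrable_cond_pdf x : mu.-integrable setT (EFin \o cond_pdf rho t x).
Proof.
rewrite /comp; under eq_fun do rewrite cond_pdfE EFinM.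
by apply: integrableZl => //; exact: integrable_pdf_kernel.
Qed.

Lemma Rintegral_cond_pdf x : \int[mu]_y cond_pdf rho t x y = 1.
Proof.
under eq_Rintegral do rewrite cond_pdfE.
rewrite RintegralZl//; last exact: integrable_pdf_kernel.
by rewrite mulVf// gt_eqF// interp_pdf_gt0.
Qed.

Lemma cond_residual_mulE x y i : (x - t *: y) ord0 i * cond_pdf rho t x y =
  (p x)^-1 * (rho y * ((x - t *: y) ord0 i * interp_kernel t y x)).
Proof. by rewrite cond_pdfE; ring. Qed.

Lemma integrable_cond_residual x i : mu.-integrable setT
  (fun y => ((x - t *: y) ord0 i * cond_pdf rho t x y)%:E).
Proof.
under eq_fun do rewrite cond_residual_mulE EFinM.
by apply: integrableZl => //; exact: integrable_pdf_residual.
Qed.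

(** A form of Tweedie's formula: the logarithm divides the gradient by p_t, which turns the weight
    [rho] times kernel into [cond_pdf]; the factor [2 * precision (1 - t)] is the inverse
    variance. *)
Lemma gradient_ln_interp_pdf x :
  differentiable (fun y => ln (p y)) x /\
  gradient (fun y => ln (p y)) x =
  - ((1 - t) ^+ 2)^-1 *: \row_i cond_residual rho t x i.
Proof.
have dl := is_diff_ln_comp _ _ _ _ (is_diff_interp_pdf x) (interp_pdf_gt0 hrho t1 x).
have df : differentiable (fun y => ln (p y)) x by [].
split => //; apply/rowP => i; rewrite !mxE deriveE// diff_val dot_delta !mxE.
rewrite /cond_residual; under [in RHS]eq_Rintegral do rewrite cond_residual_mulE.
rewrite RintegralZl//; last exact: integrable_pdf_residual.
rewrite mulrCA; congr (_ * _).
by rewrite /precision; field.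
Qed.

(** One statement serves both a^1 and a^1 - z. The constant part [a *: x] is unchanged because
    [cond_pdf] has total mass 1. *)
Lemma cond_expect_affine x (a b : R)
    (g : 'rV[R]_d -> 'rV[R]_d -> 'rV[R]_d) :
  (forall y, g y (noise t x y) = a *: x + b *: (x - t *: y)) ->
  cond_integrable rho t x g /\
  cond_expect rho t x g = a *: x + b *: \row_i cond_residual rho t x i.
Proof.
move=> gE.
have E i y : g y (noise t x y) ord0 i * cond_pdf rho t x y =
    (a * x ord0 i) * cond_pdf rho t x y +
    b * ((x - t *: y) ord0 i * cond_pdf rho t x y).
  by rewrite gE !mxE; ring.
have i1 i := integrableZl measurableT (a * x ord0 i) (integrable_cond_pdf x).
have i2 i := integrableZl measurableT b (integrable_cond_residual x i).
split=> [i|].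
  by under eq_fun do rewrite E EFinD; exact: (integrableD measurableT (i1 i) (i2 i)).
apply/rowP => i; rewrite !mxE; under eq_Rintegral do rewrite E.
rewrite (RintegralD measurableT (i1 i) (i2 i)).
rewrite (RintegralZl (a * x ord0 i) measurableT (integrable_cond_pdf x)).
rewrite (RintegralZl b measurableT (integrable_cond_residual x i)).
by rewrite Rintegral_cond_pdf mulr1.
Qed.

End score.

(** * Affine change of variables *)

Section affine.
Context {R : realType}.
Local Open Scope ereal_scope.

Lemma measurable_affine (a c : R) :
  measurable_fun [set: measurableTypeR R]
    ((fun x : R => a + c * x)%R : _ -> measurableTypeR R).
Proof. by apply: measurable_funD => //; apply: measurable_funM. Qed.

(* The measure instance of [pushforward] takes a measurability proof that
   unification does not find, hence the explicit generated name. *)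
Definition affine_measure (a : R) (c : {nonneg R}) :
    {measure set (measurableTypeR R) -> \bar R} :=
  mscale c (measure_function_pushforward__canonical__measure_function_Measure
    lebesgue_measure (measurable_affine a c%:num)).

(** By uniqueness of Lebesgue measure it suffices to compare half-open intervals: the preimage has
    its length divided by [c], which the scaling restores. *)
Lemma affine_measureE (a : R) (c : {nonneg R}) (A : set R) :
  (0 < c%:num)%R -> measurable A -> lebesgue_measure A = affine_measure a c A.
Proof.
move=> c0 mA; apply: lebesgue_measure_unique => // _ [[x y] _ <-].
have PE : (fun z => a + c%:num * z)%R @^-1` `]x, y] =
    `](x - a) / c%:num, (y - a) / c%:num]%classic%R.
  apply/seteqP; split=> z /=; rewrite !in_itv/= ltr_pdivrMr// ler_pdivlMr//;
    by rewrite ltrBlDl lerBrDl [(z * _)%R]mulrC.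
rewrite [RHS](_ : _ = c%:num%:E *
  lebesgue_measure `](x - a) / c%:num, (y - a) / c%:num]%classic%R); last first.
  by rewrite -PE.
rewrite !lebesgue_measure_itv/= !lte_fin ltr_pM2r ?invr_gt0// ltrD2r.
case: ifPn => _; last by rewrite mule0.
rewrite -!EFinB -EFinM; congr EFin; field.
by rewrite gt_eqF.
Qed.

Lemma ge0_integral_affine (f : R -> \bar R) (a c : R) : (0 < c)%R ->
  measurable_fun setT f -> (forall x, 0 <= f x) ->
  \int[lebesgue_measure]_x f x =
  c%:E * \int[lebesgue_measure]_x f (a + c * x)%R.
Proof.
move=> c0 mf f0; pose c' : {nonneg R} := NngNum (ltW c0).
rewrite (eq_measure_integral (affine_measure a c'))/=; last first.
  by move=> A mA _; exact: affine_measureE.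
rewrite ge0_integral_mscale//=; congr (_ * _).
by rewrite (ge0_integral_pushforward (measurable_affine a c))// preimage_setT.
Qed.

(** Lebesgue measure in dimension [d.+1] is by construction an image of a product measure, so this
    is transport along [cons_rV] followed by Tonelli. *)
Lemma ge0_integral_lebesgue_rVS d (f : 'rV[R]_d.+1 -> \bar R) :
  measurable_fun setT f -> (forall x, 0 <= f x) ->
  \int[lebesgue_rV d.+1]_x f x =
  \int[lebesgue_measure]_a \int[lebesgue_rV d]_v f (cons_rV (a, v)).
Proof.
move=> mf f0.
have mc := @measurable_cons_rV R d.
rewrite [LHS](ge0_integral_pushforward mc)// preimage_setT.
rewrite fubini_tonelli1 => [//||u]; last exact: f0.
exact: (measurableT_comp mf mc).
Qed.

Lemma measurable_rV_affine d (m : 'rV[R]_d) (c : R) :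
  measurable_fun setT (fun x : 'rV[R]_d => m + c *: x)%R.
Proof.
rewrite (_ : (fun _ => _) = (fun x => 1 *: cst m x + c *: id x)%R).
  exact: measurable_rV_lincomb.
by apply/funext => x; rewrite scale1r.
Qed.

(** Induction on the dimension: the first coordinate is treated by the one-dimensional substitution,
    the others by the induction hypothesis with the tail of [m]. Each coordinate yields one factor
    [c]. *)
Lemma ge0_integral_rV_affine d (f : 'rV[R]_d -> \bar R) (m : 'rV[R]_d) (c : R) :
  (0 < c)%R -> measurable_fun setT f -> (forall x, 0 <= f x) ->
  \int[lebesgue_rV d]_x f x =
  (c ^+ d)%:E * \int[lebesgue_rV d]_x f (m + c *: x)%R.
Proof.
move=> c0; elim: d => [|d ih] in f m * => mf f0.
  rewrite expr0 mul1e; apply: eq_integral => x _.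
  by rewrite [x]thinmx0 [(_ + _)%R]thinmx0.
have maff : measurable_fun setT (fun x : 'rV[R]_d.+1 => f (m + c *: x)%R).
  exact: (measurableT_comp mf (measurable_rV_affine _ m c)).
rewrite !ge0_integral_lebesgue_rVS//.
have fE a v : f (m + c *: cons_rV (a, v))%R =
    f (cons_rV (m ord0 ord0 + c * a, \row_j m ord0 (lift ord0 j) + c *: v))%R.
  congr f; apply/rowP => i; rewrite !mxE; case: unliftP => [j|] -> //=.
  by rewrite !mxE.
have mF (g : 'rV[R]_d.+1 -> \bar R) : measurable_fun setT g ->
    (forall x, 0 <= g x) ->
    measurable_fun setT (fun a => \int[lebesgue_rV d]_v g (cons_rV (a, v))).
  move=> mg g0; apply: (measurable_fun_fubini_tonelli_F (g \o @cons_rV R d)).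
    exact: (measurableT_comp mg (@measurable_cons_rV R d)).
  by move=> ?; exact: g0.
rewrite (@ge0_integral_affine (fun a => \int[lebesgue_rV d]_v f (cons_rV (a, v)))
  (m ord0 ord0) c c0 (mF f mf f0)); last by move=> a; exact: integral_ge0.
rewrite exprSr mulrC EFinM -muleA; congr (_ * _).
rewrite -ge0_integralZl//; last 3 first.
- exact: (mF (fun x => f (m + c *: x)%R)).
- by move=> a _; exact: integral_ge0.
- by rewrite lee_fin exprn_ge0// ltW.
apply: eq_integral => a _.
rewrite (ih _ (\row_j m ord0 (lift ord0 j)))//; last first.
  apply: (measurableT_comp mf).
  exact: (measurableT_comp (@measurable_cons_rV R d) (pair1_measurable _)).
by congr (_ * _); apply: eq_integral => v _; rewrite fE.
Qed.

End affine.

(** * Joint densities *)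

Section density_measure.
Local Open Scope ereal_scope.
Context {R : realType} {disp : measure_display} {T : measurableType disp}.
Variables (mu : {measure set T -> \bar R}) (f : T -> R).
Hypotheses (mf : measurable_fun setT f) (f0 : forall x, (0 <= f x)%R).

(** The two proofs are arguments so that the measure structure, which depends on them, is attached
    to the term itself. *)
Definition density_measure & measurable_fun setT f & (forall x, (0 <= f x)%R) :=
  fun A : set T => \int[mu]_(x in A) (f x)%:E.

Local Notation nu := (density_measure mf f0).

Let nu0 : nu set0 = 0.
Proof. exact: integral_set0. Qed.

Let nu_ge0 A : 0 <= nu A.
Proof. by apply: integral_ge0 => x _; rewrite lee_fin. Qed.

Let nu_sigma_additive : semi_sigma_additive nu.
Proof.
move=> F mF tF mUF; apply: cvg_toP.
  apply: ereal_nondecreasing_is_cvgn => m n mn.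
  by apply: lee_sum_nneg_natr => // k _ _; exact: nu_ge0.
rewrite /density_measure ge0_integral_bigcup//.
- exact/measurable_EFinP/measurable_funTS.
- by move=> x _; rewrite lee_fin.
Qed.

HB.instance Definition _ := isMeasure.Build _ _ _ nu
  nu0 nu_ge0 nu_sigma_additive.

End density_measure.

Section joint_density.
Local Open Scope ereal_scope.
Context {R : realType} {disp : measure_display} {Omega : measurableType disp}
  {P : probability Omega R}.
Context {disp1 : measure_display} {T1 : measurableType disp1}.
Context {disp2 : measure_display} {T2 : measurableType disp2}.
Variables (mu1 : {sigma_finite_measure set T1 -> \bar R})
  (mu2 : {sigma_finite_measure set T2 -> \bar R}).

(** The indicator of a rectangle factors, so Tonelli splits the integral. *)
Lemma ge0_integral_setX_prod (f1 : T1 -> R) (f2 : T2 -> R) A B :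
  measurable_fun setT f1 -> measurable_fun setT f2 ->
  (forall x, (0 <= f1 x)%R) -> (forall y, (0 <= f2 y)%R) ->
  measurable A -> measurable B ->
  \int[mu1 \x mu2]_(w in A `*` B) (f1 w.1 * f2 w.2)%:E =
  (\int[mu1]_(x in A) (f1 x)%:E) * \int[mu2]_(y in B) (f2 y)%:E.
Proof.
move=> m1 m2 p1 p2 mA mB.
have mf : measurable_fun setT (fun w : T1 * T2 => f1 w.1 * f2 w.2)%R.
  by apply: measurable_funM; exact: measurableT_comp.
rewrite integral_mkcond fubini_tonelli1; last 2 first.
- apply/(measurable_restrictT _ _).1; first exact: measurableX.
  exact/measurable_EFinP/measurable_funTS.
- by move=> w; apply: erestrict_ge0 => ? _; rewrite lee_fin mulr_ge0.
rewrite /fubini_F.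
have E x y : ((fun w => (f1 w.1 * f2 w.2)%:E) \_ (A `*` B)) (x, y) =
    ((EFin \o f1) \_ A) x * ((EFin \o f2) \_ B) y.
  rewrite !patchE in_setX; case: (x \in A) => /=; last by rewrite mul0e.
  by case: (y \in B) => /=; rewrite ?mule0.
have mr1 : measurable_fun setT ((EFin \o f1) \_ A).
  by apply/(measurable_restrictT _ _).1 => //; exact/measurable_EFinP/measurable_funTS.
have mr2 : measurable_fun setT ((EFin \o f2) \_ B).
  by apply/(measurable_restrictT _ _).1 => //; exact/measurable_EFinP/measurable_funTS.
have r1 x : 0 <= ((EFin \o f1) \_ A) x.
  by apply: erestrict_ge0 => ? _; rewrite /= lee_fin.
have r2 y : 0 <= ((EFin \o f2) \_ B) y.
  by apply: erestrict_ge0 => ? _; rewrite /= lee_fin.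
under eq_integral => x _.
  under eq_integral do rewrite E.
  rewrite ge0_integralZl//.
  over.
rewrite ge0_integralZr//; last exact: integral_ge0.
by rewrite -!integral_mkcond.
Qed.

Lemma has_density_pair (X : {RV P >-> T1}) (Y : {RV P >-> T2})
    (f1 : T1 -> R) (f2 : T2 -> R) :
  measurable_fun setT f1 -> measurable_fun setT f2 ->
  (forall x, (0 <= f1 x)%R) -> (forall y, (0 <= f2 y)%R) ->
  has_density P mu1 X f1 -> has_density P mu2 Y f2 -> independent_rv X Y ->
  has_density P (mu1 \x mu2) (fun w => (X w, Y w))
    (fun w => f1 w.1 * f2 w.2)%R.
Proof.
move=> m1 m2 p1 p2 dX dY XY A mA.
have mf : measurable_fun setT (fun w : T1 * T2 => f1 w.1 * f2 w.2)%R.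
  by apply: measurable_funM; exact: measurableT_comp.
have f0 (w : T1 * T2) : (0 <= f1 w.1 * f2 w.2)%R by rewrite mulr_ge0.
have mXY : measurable_fun setT (fun w => (X w, Y w)).
  by apply: measurable_fun_pair.
pose law : {measure set (T1 * T2) -> \bar R} :=
  measure_function_pushforward__canonical__measure_function_Measure P mXY.
pose dens : {measure set (T1 * T2) -> \bar R} :=
  density_measure (mu1 \x mu2) _ mf f0.
(* Both the joint law and the measure with the product density agree on rectangles with the product
   of the marginal laws: the first by independence, the second by [ge0_integral_setX_prod]. *)
transitivity ((distribution P X \x distribution P Y) A); last first.
  rewrite -[RHS]/(dens A); apply: product_measure_unique => // B C mB mC.
  rewrite [LHS]ge0_integral_setX_prod//.
  by congr (_ * _); rewrite -?dX -?dY.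
rewrite -[LHS]/(law A); apply/esym; apply: product_measure_unique => //.
Qed.

End joint_density.

Lemma measurable_EFin_restrict {R : realType} {disp : measure_display}
    {T : measurableType disp} (A : set T) (f : T -> R) :
  measurable A -> measurable_fun setT f ->
  measurable_fun setT ((fun x => (f x)%:E) \_ A).
Proof.
move=> mA mf; apply/(measurable_restrictT _ mA).1.
by apply: measurable_funTS; exact/measurable_EFinP.
Qed.

Lemma EFin_restrict_ge0 {R : realType} {T : Type} (A : set T) (f : T -> R) x :
  (forall x, 0 <= f x) -> (0 <= ((fun x => (f x)%:E) \_ A) x)%E.
Proof. by move=> f0; apply: erestrict_ge0 => y _; rewrite lee_fin. Qed.

(** * Laws of (a^1, a^t) and of a^t *)

Section law_of_interp.
Context {R : realType} {d : nat} {rho : 'rV[R]_d -> R} {t : R}.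
Hypotheses (hrho : is_pdf rho) (t1 : 0 < 1 - t).
Implicit Types x y z : 'rV[R]_d.

Local Notation mu := (lebesgue_rV (R := R) d).
Local Notation phi := (gaussian_pdf 0 1%:M).

Let t1' : 1 - t != 0. Proof. by rewrite gt_eqF. Qed.

Let mrho : measurable_fun setT rho. Proof. by case: hrho. Qed.

Let rho0 y : 0 <= rho y. Proof. by case: hrho => _ + _; exact. Qed.

Lemma gaussian_pdf01E z : phi z =
  gauss_cst (d := d) 1 * expR (- (precision 1 * sqnorm z)).
Proof. by rewrite -[X in X%:M](expr1n R 2) gaussian_pdf_scalarE ?subr0. Qed.

(** At the point [t *: y + (1 - t) *: z] the residual is [(1 - t) *: z], so the variance cancels in
    the exponent, and the Jacobian [(1 - t) ^+ d] cancels in the normalizing constant. *)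
Lemma interp_kernel_interp y z :
  (1 - t) ^+ d * interp_kernel t y (t *: y + (1 - t) *: z) = phi z.
Proof.
rewrite interp_kernelE// gaussian_pdf01E addrAC subrr add0r mulrA.
congr (_ * expR (- _)).
  rewrite /gauss_cst !expr1n mulr1 sqrtrM ?exprn_ge0 ?mulr_ge0 ?pi_ge0//.
  (* The square root of the determinant is [(1 - t) ^+ d], without absolute value since [1 - t] is
     positive. *)
  rewrite -exprM mulnC exprM sqrtr_sqr ger0_norm ?exprn_ge0 ?(ltW t1)//.
  by rewrite invfM mulrCA mulfV ?mulr1// expf_neq0.
rewrite /precision expr1n mulr1 /sqnorm invfM -mulrA mulr_sumr.
congr (_ * _); apply: eq_bigr => i _.
by rewrite mxE exprMn mulrA mulVf ?mul1r// expf_neq0.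
Qed.

Lemma measurable_joint :
  measurable_fun setT
    (fun w : 'rV[R]_d * 'rV[R]_d => rho w.1 * interp_kernel t w.1 w.2).
Proof.
apply: measurable_funM; first exact: measurableT_comp.
exact: measurable_interp_kernel.
Qed.

Lemma joint_ge0 y x : 0 <= rho y * interp_kernel t y x.
Proof. by rewrite mulr_ge0// ltW// interp_kernel_gt0. Qed.

Context {disp : measure_display} {Omega : measurableType disp}
  {P : probability Omega R}.
Variables (a1 z : {RV P >-> 'rV[R]_d}).
Hypotheses (ha1 : has_density P mu a1 rho) (hz : has_density P mu z phi)
  (hind : independent_rv a1 z).

Local Open Scope ereal_scope.

Lemma has_density_joint :
  has_density P (mu \x mu) (fun w => (a1 w, interp t (a1 w) (z w)))
    (fun yx => rho yx.1 * interp_kernel t yx.1 yx.2)%R.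
Proof.
move=> A mA.
have mphi : measurable_fun setT (phi : 'rV[R]_d -> R).
  rewrite (funext gaussian_pdf01E).
  apply: measurable_funM => //; apply: measurableT_comp => //.
  apply: measurableT_comp => //; apply: measurable_funM => //.
  exact: measurable_sqnorm.
have phi0 x : (0 <= phi x :> R)%R.
  by rewrite gaussian_pdf01E mulr_ge0 ?expR_ge0// ltW// gauss_cst_gt0 ?oner_neq0.
(* (a^1, a^t) is the image of (a^1, z) under [T], which leaves the first component fixed; hence only
   the inner integral needs a substitution. *)
pose T (w : 'rV[R]_d * 'rV[R]_d) := (w.1, interp t w.1 w.2).
have mT : measurable_fun setT T.
  apply: measurable_fun_pair => //.
  exact: measurable_rV_lincomb.
have mTA : measurable (T @^-1` A) by rewrite -[X in measurable X]setTI; exact: mT.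
have := has_density_pair _ _ _ _ _ _ mrho mphi rho0 phi0 ha1 hz hind _ mTA.
rewrite -[X in P X]/((fun w => (a1 w, interp t (a1 w) (z w))) @^-1` A) => ->.
rewrite [LHS]integral_mkcond [RHS]integral_mkcond.
have mf := measurable_joint.
have m2 : measurable_fun setT (fun w : 'rV[R]_d * 'rV[R]_d => rho w.1 * phi w.2)%R.
  by apply: measurable_funM; exact: measurableT_comp.
have mg : measurable_fun setT
    ((fun yx => (rho yx.1 * interp_kernel t yx.1 yx.2)%:E) \_ A).
  exact: (measurable_EFin_restrict _ _ mA mf).
have g0 w : 0 <= ((fun yx => (rho yx.1 * interp_kernel t yx.1 yx.2)%:E) \_ A) w.
  by apply: EFin_restrict_ge0 => ?; exact: joint_ge0.
rewrite [RHS](fubini_tonelli1 _ mg g0).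
rewrite [LHS](fubini_tonelli1 _ (measurable_EFin_restrict _ _ mTA m2)); last first.
  by move=> w; apply: EFin_restrict_ge0 => ?; rewrite mulr_ge0.
apply: eq_integral => y _; rewrite /fubini_F.
have mgy := measurableT_comp mg (pair1_measurable y).
(* For fixed [y], substitute [t *: y + (1 - t) *: z] for the second variable. *)
rewrite [RHS](ge0_integral_rV_affine _ _ (t *: y) _ t1 mgy (fun x => g0 (y, x))).
have mgay := measurableT_comp mgy (measurable_rV_affine _ (t *: y) (1 - t)%R).
rewrite -(ge0_integralZl mu measurableT mgay); last 2 first.
- by move=> x _; exact: g0.
- by rewrite lee_fin exprn_ge0// ltW.
apply: eq_integral => x _; rewrite /= !patchE.
rewrite (_ : ((y, x) \in T @^-1` A) = ((y, (t *: y + (1 - t) *: x)%R) \in A)); last first.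
  by apply/idP/idP; rewrite !inE.
case: ifPn => _; last by rewrite mule0.
by rewrite -EFinM [in RHS]mulrCA [in RHS]interp_kernel_interp.
Qed.

Lemma integral_joint x :
  \int[mu]_y (rho y * interp_kernel t y x)%:E = (interp_pdf rho t x)%:E.
Proof.
rewrite /interp_pdf /Rintegral fineK//; apply: integrable_fin_num => //.
exact: integrable_pdf_kernel.
Qed.

Lemma has_density_interp :
  has_density P mu (fun w => interp t (a1 w) (z w)) (interp_pdf rho t).
Proof.
move=> B mB.
have mTB : measurable ([set: 'rV[R]_d] `*` B) by exact: measurableX.
have := has_density_joint _ mTB.
rewrite [X in P X](_ : _ = (fun w => interp t (a1 w) (z w)) @^-1` B); last first.
  by apply/seteqP; split => w //= -[].
move=> ->; rewrite [LHS]integral_mkcond [RHS]integral_mkcond.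
have mf := measurable_joint.
have mg : measurable_fun setT
    ((fun yx => (rho yx.1 * interp_kernel t yx.1 yx.2)%:E) \_ (setT `*` B)).
  exact: measurable_EFin_restrict.
have g0 w : 0 <= ((fun yx => (rho yx.1 * interp_kernel t yx.1 yx.2)%:E) \_ (setT `*` B)) w.
  by apply: erestrict_ge0 => ? _; rewrite lee_fin joint_ge0.
(* Tonelli exchanges the order so that [y] becomes the inner variable, whose integral is p_t. *)
rewrite fubini_tonelli1// fubini_tonelli//.
apply: eq_integral => x _; rewrite patchE.
under eq_integral do rewrite patchE in_setX in_setT/=.
case: ifPn => _; last by rewrite integral0.
exact: integral_joint.
Qed.

(** The normalization is read off the law: the integral of p_t is the probability that a^t lies
    anywhere. *)
Lemma is_pdf_interp : is_pdf (interp_pdf rho t).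
Proof.
split.
- apply/measurable_EFinP; rewrite /comp; under eq_fun do rewrite -integral_joint.
  apply: (measurable_fun_fubini_tonelli_G
    (fun yx => (rho yx.1 * interp_kernel t yx.1 yx.2)%:E)).
    by apply/measurable_EFinP; exact: measurable_joint.
  by move=> w; rewrite lee_fin joint_ge0.
- by move=> x; rewrite ltW// interp_pdf_gt0.
- by rewrite -has_density_interp// preimage_setT probability_setT.
Qed.

End law_of_interp.

(** * The two score formulas for the interpolation path *)

Theorem lemmaC4 (R : realType) (d : nat) (hd : (1 <= d)%N)
  (S : Type) (s : S) (pi_beta : S -> 'rV[R]_d -> R)
  (hpi : is_pdf (pi_beta s))
  (disp : measure_display) (Omega : measurableType disp)
  (P : probability Omega R)
  (a1 z : {RV P >-> 'rV[R]_d})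
  (ha1 : has_density P (lebesgue_rV d) a1 (pi_beta s))
  (hz : has_density P (lebesgue_rV d) z (gaussian_pdf 0 1%:M))
  (hind : independent_rv a1 z) :
  forall t : R, 0 < t < 1 ->
  let at_ := fun w => interp t (a1 w) (z w) in
  let p := interp_pdf (pi_beta s) t in
  let E_a1 := fun x => cond_expect (pi_beta s) t x (fun y _ => y) in
  let v := velocity pi_beta in
  (* p_t is the density of a^t, and the joint density of (a^1, a^t) is the one
     from which the conditional density of a^1 given a^t is computed *)
  [/\ is_pdf p,
      has_density P (lebesgue_rV d) at_ p,
      has_density P (lebesgue_rV d \x lebesgue_rV d)%E
        (fun w => (a1 w, at_ w))
        (fun yx => pi_beta s yx.1 * interp_kernel t yx.1 yx.2)
    & forall x : 'rV[R]_d,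
      [/\ 0 < p x /\ differentiable (fun x' => ln (p x')) x,
          cond_integrable (pi_beta s) t x (fun y _ => y),
          cond_integrable (pi_beta s) t x (fun y w => y - w),
          gradient (fun x' => ln (p x')) x
            = ((1 - t) ^+ 2)^-1 *: (t *: E_a1 x - x)
        & gradient (fun x' => ln (p x')) x
            = (1 - t)^-1 *: (t *: v t s x - x)]].
Proof.
move=> t /andP[t0 t1] at_ p E_a1 v.
have c0 : 0 < 1 - t by rewrite subr_gt0.
have c0' : 1 - t != 0 by rewrite gt_eqF.
have t0' : t != 0 by rewrite gt_eqF.
split.
- exact: (is_pdf_interp hpi c0 a1 z ha1 hz hind).
- exact: (has_density_interp hpi c0 a1 z ha1 hz hind).
- exact: (has_density_joint hpi c0 a1 z ha1 hz hind).
move=> x; have [dl gE] := gradient_ln_interp_pdf hpi c0' x.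
have aE y : y = t^-1 *: x + - t^-1 *: (x - t *: y).
  by apply/rowP => i; rewrite !mxE; field.
(* The noise is [(1 - t)^-1] times the residual, which accounts for the second term of the
   coefficient. *)
have vE y : y - noise t x y =
    t^-1 *: x + (- t^-1 - (1 - t)^-1) *: (x - t *: y).
  by apply/rowP => i; rewrite !mxE; field; rewrite t0' c0'.
have [ia Ea] := cond_expect_affine hpi c0' x _ _ (fun y _ => y) aE.
have [iv Ev] := cond_expect_affine hpi c0' x _ _ (fun y w => y - w) vE.
split=> //; first by split=> //; exact: interp_pdf_gt0.
(* With [m] the vector of residual means, [t *: E_a1 x - x] equals [- m]. *)
- rewrite gE /E_a1 Ea; apply/rowP => i; rewrite !mxE; field.
  by rewrite t0' c0'.
(* Here [t *: v t s x - x] is [- (1 + t / (1 - t)) *: m], that is [- (1 - t)^-1 *: m]; hence a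
   single remaining factor [(1 - t)^-1]. *)
- rewrite gE /v /velocity Ev; apply/rowP => i; rewrite !mxE; field.
  by rewrite t0' c0'.
Qed.
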